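(* Let $G=(V,E)$ be a simple, finite, connected, undirected graph with at least two vertices and vertex degrees $d_v$, and for $\alpha\in\mathbb{R}$ let $$\bar R_\alpha=\frac{\sum_{uv\in E}(d_ud_v)^\alpha}{\sum_{v\in V}(d_v)^{2\alpha}}$$ be its normalized Randi\'c function. Let $H_E^\alpha$ and $H_V^\alpha$ be the Shannon entropies of the probability distributions on $E$ and $V$ given by $$p_E^\alpha(uv)=\frac{(d_ud_v)^\alpha}{\sum_{xy\in E}(d_xd_y)^\alpha},\qquad p_V^\alpha(v)=\frac{(d_v^2)^\alpha}{\sum_{x\in V}(d_x^2)^\alpha}.$$ Then for all $\alpha\neq 0$, $$\frac{\partial}{\partial\alpha}\log\bar R_\alpha=\frac1\alpha\left(\log\bar R_\alpha+H_V^\alpha-H_E^\alpha\right).$$ Consequently, at a point $\alpha=\alpha^*$ where $\bar R_\alpha$ (as a function of $\alpha\in\mathbb{R}$) reaches its maximum, $$\log\bar R_{\alpha^*}=H_E^{\alpha^*}-H_V^{\alpha^*}.$$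
   Context: $\log$ denotes the logarithm in base $2$. Sums over $E$ are over undirected edges, each counted once. The Shannon entropies are $$H_E^\alpha=-\sum_{uv\in E}p_E^\alpha(uv)\log p_E^\alpha(uv),\qquad H_V^\alpha=-\sum_{v\in V}p_V^\alpha(v)\log p_V^\alpha(v).$$ *)

(* Defs.v *)
From mathcomp Require Import all_boot all_order all_algebra.
From mathcomp Require Import all_classical all_reals all_analysis.

Set Implicit Arguments.
Unset Strict Implicit.
Unset Printing Implicit Defensive.

Import Order.TTheory GRing.Theory Num.Theory.
Import numFieldNormedType.Exports.

Local Open Scope ring_scope.

Definition log2 (R : realType) (x : R) : R := ln x / ln 2.

Definition simple_graph (V : finType) (adj : rel V) : Prop :=
  symmetric adj /\ irreflexive adj.

Definition connected_graph (V : finType) (adj : rel V) : Prop :=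
  forall u v : V, connect adj u v.

Definition deg (V : finType) (adj : rel V) (v : V) : nat :=
  #|[set u | adj v u]|.

(* An edge is the unordered pair of its endpoints, so a sum over [edges adj]
   counts each undirected edge once. *)
Definition edges (V : finType) (adj : rel V) : {set {set V}} :=
  [set [set u; v] | u in V, v in adj u].

(* For an edge [f = [set u; v]] of a simple graph, [u != v] and the product is
   d_u * d_v. *)
Definition edge_deg (V : finType) (adj : rel V) (f : {set V}) : nat :=
  (\prod_(v in f) deg adj v)%N.

(* Connectedness and [1 < #|V|] make all degrees positive, so the base of each
   [powR] below is positive and its convention at 0 plays no role. *)
Definition normalized_randic (R : realType) (V : finType) (adj : rel V)
    (a : R) : R :=
  (\sum_(f in edges adj) (edge_deg adj f)%:R `^ a) /
  (\sum_(v : V) (deg adj v)%:R `^ (2 * a)).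

Definition edge_prob (R : realType) (V : finType) (adj : rel V)
    (a : R) (f : {set V}) : R :=
  (edge_deg adj f)%:R `^ a / \sum_(g in edges adj) (edge_deg adj g)%:R `^ a.

Definition vertex_prob (R : realType) (V : finType) (adj : rel V)
    (a : R) (v : V) : R :=
  ((deg adj v)%:R ^+ 2) `^ a / \sum_(x : V) ((deg adj x)%:R ^+ 2) `^ a.

Definition edge_entropy (R : realType) (V : finType) (adj : rel V)
    (a : R) : R :=
  - \sum_(f in edges adj) edge_prob adj a f * log2 (edge_prob adj a f).

Definition vertex_entropy (R : realType) (V : finType) (adj : rel V)
    (a : R) : R :=
  - \sum_(v : V) vertex_prob adj a v * log2 (vertex_prob adj a v).

(* Main.v *)
Require Import Defs.
From mathcomp Require Import all_boot all_order all_algebra.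
From mathcomp Require Import all_classical all_reals all_analysis.
From mathcomp Require Import ring.

Import Order.TTheory GRing.Theory Num.Theory.
Import numFieldNormedType.Exports.

Local Open Scope ring_scope.

(** Both sums in the normalized Randic function are partition functions: for
    positive weights [w i], put [Z b = \sum_i w i `^ b], with [w] the product
    of the degrees of the endpoints on edges and the squared degree on
    vertices.  The distribution [p i = w i `^ b / Z b] is then the Gibbs
    distribution with energies [ln (w i)], and since
    [ln (p i) = b * ln (w i) - ln (Z b)], its entropy is governed by the
    thermodynamic identity
      H b = log2 (Z b) - b * (log2 \o Z)' b
    (lemmas [gibbs_entropy] and [is_derive_log2_powsum]).  As
    [log2 R = log2 ZE - log2 ZV], subtracting the identity for vertices from
    the one for edges gives, for every [b],
      b * (log2 \o R)' b = log2 (R b) + HV b - HE b.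
    Dividing by [b] when [b != 0] yields the derivative formula.  At a maximum
    of [R] the function [log2 \o R] is maximal too, so its derivative vanishes
    and the identity, still undivided, gives [log2 R = HE - HV], also when the
    maximum is reached at [0].  Connectedness supplies the
    positivity of the weights and of the partition functions: with at least
    two vertices no vertex is isolated, and hence there is an edge. *)

(** * Power sums and Gibbs distributions *)

Definition powsum {R : realType} {I : finType} (P : pred I) (w : I -> R)
    (b : R) : R :=
  \sum_(i | P i) w i `^ b.

Definition dpowsum {R : realType} {I : finType} (P : pred I) (w : I -> R)
    (b : R) : R :=
  \sum_(i | P i) w i `^ b * ln (w i).

Lemma ln2_gt0 (R : realType) : 0 < ln (2 : R).
Proof. by rewrite ln_gt0// ltr1n. Qed.

Lemma log2_div (R : realType) (x y : R) :
  0 < x -> 0 < y -> log2 (x / y) = log2 x - log2 y.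
Proof. by move=> x0 y0; rewrite /log2 ln_div ?posrE// mulrBl. Qed.

Lemma is_derive_log2 (R : realType) (f : R -> R) (x df : R) :
  0 < f x -> is_derive x 1 f df ->
  is_derive x 1 (fun y => log2 (f y)) (df / f x / ln 2).
Proof.
move=> fx0 fdf.
have dln := is_derive1_ln fx0.
have -> : (fun y => log2 (f y)) = (ln 2)^-1 \*: (@ln R \o f).
  by apply/funext => y; rewrite /log2 /= mulrC.
apply: is_derive_eq; rewrite /GRing.scale /=.
by rewrite mulrC (mulrC df).
Qed.

Lemma powsum_gt0 (R : realType) (I : finType) (P : pred I) (w : I -> R)
    (b : R) (i : I) :
  P i -> (forall j, P j -> 0 < w j) -> 0 < powsum P w b.
Proof.
move=> Pi w0; rewrite /powsum (bigD1 i)//= ltr_pwDl ?powR_gt0 ?w0//.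
by apply: sumr_ge0 => j _; rewrite powR_ge0.
Qed.

Lemma is_derive_powR_exponent (R : realType) (x b : R) :
  0 < x -> is_derive b 1 (fun c => x `^ c) (x `^ b * ln x).
Proof.
move=> x0.
have E c : x `^ c = expR (ln x * c) by rewrite /powR gt_eqF// mulrC.
have -> : (fun c => x `^ c) = @expR R \o (ln x \*: id).
  by apply/funext => c; rewrite E.
rewrite E; apply: is_derive_eq.
by rewrite /GRing.scale /= mulr1.
Qed.

Lemma is_derive_powsum (R : realType) (I : finType) (P : pred I) (w : I -> R)
    (b : R) :
  (forall i, P i -> 0 < w i) ->
  is_derive b 1 (powsum P w) (dpowsum P w b).
Proof.
move=> w0.
have -> : powsum P w = \sum_(i | P i) (fun c => w i `^ c).
  by apply/funext => c; rewrite /powsum fct_sumE.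
rewrite /dpowsum.
apply: (big_ind2 (fun f df => is_derive b 1 f df)) => [|f df g dg Hf Hg|i Pi].
- exact: is_derive_cst.
- exact: is_deriveD.
- exact/is_derive_powR_exponent/w0.
Qed.

Lemma is_derive_log2_powsum (R : realType) (I : finType) (P : pred I)
    (w : I -> R) (b : R) :
  (forall i, P i -> 0 < w i) -> 0 < powsum P w b ->
  is_derive b 1 (fun c => log2 (powsum P w c))
    (dpowsum P w b / powsum P w b / ln 2).
Proof. by move=> w0 Z0; exact/is_derive_log2/is_derive_powsum. Qed.

(** The entropy is the mean of [- log2 p i], which is affine in [ln (w i)];
    the mean of [ln (w i)] is the logarithmic derivative of the power sum. *)
Lemma gibbs_entropy (R : realType) (I : finType) (P : pred I) (w : I -> R)
    (b : R) :
  (forall i, P i -> 0 < w i) -> 0 < powsum P w b ->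
  - (\sum_(i | P i) w i `^ b / powsum P w b * log2 (w i `^ b / powsum P w b))
  = log2 (powsum P w b) - b * (dpowsum P w b / powsum P w b / ln 2).
Proof.
move=> w0; set Z := powsum P w b => Z0.
have ln2N0 : ln (2 : R) != 0 by rewrite gt_eqF ?ln2_gt0.
have ZN0 : Z != 0 by rewrite gt_eqF.
transitivity (- \sum_(i | P i) (b / Z / ln 2 * (w i `^ b * ln (w i))
                                - log2 Z / Z * w i `^ b)).
  congr (- _); apply: eq_bigr => i Pi.
  rewrite log2_div ?powR_gt0 ?w0// {1}/log2 ln_powR; field.
  by rewrite ln2N0 ZN0.
rewrite sumrB -!mulr_sumr -/(powsum P w b) -/Z -/(dpowsum P w b).
by field; rewrite ln2N0 ZN0.
Qed.

(** * Positivity of degrees in a connected graph *)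

Section ConnectedGraph.
Context {V : finType} {adj : rel V}.
Hypothesis adj_connected : connected_graph adj.
Hypothesis V_ge2 : (2 <= #|V|)%N.

Lemma exists_neighbour (v : V) : exists u, adj v u.
Proof.
have [u uv] : exists u, u != v.
  have /card_gt1P[x [y [_ _ xy]]] := V_ge2.
  by have [xv|xv] := eqVneq x v; [exists y; rewrite -xv eq_sym | exists x].
(* A path from [v] to another vertex has a first step. *)
case/connectP: (adj_connected v u) => -[|x p] /= pth lst.
  by rewrite lst eqxx in uv.
by exists x; case/andP: pth.
Qed.

Lemma deg_gt0 (v : V) : (0 < deg adj v)%N.
Proof.
have [u vu] := exists_neighbour v.
by apply/card_gt0P; exists u; rewrite inE.
Qed.

Lemma edge_deg_gt0 (f : {set V}) : (0 < edge_deg adj f)%N.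
Proof. by rewrite prodn_gt0// => v; exact: deg_gt0. Qed.

Lemma exists_vertex : exists v : V, true.
Proof. by case/card_gt0P: (ltnW V_ge2) => v _; exists v. Qed.

Lemma exists_edge : exists f, f \in edges adj.
Proof.
have [v _] := exists_vertex; have [u vu] := exists_neighbour v.
by exists [set v; u]; apply/imset2P; exists v u.
Qed.

End ConnectedGraph.

(** * The Randic function as a quotient of power sums *)

Section Randic.
Context {R : realType} {V : finType} {adj : rel V}.
Hypothesis adj_connected : connected_graph adj.
Hypothesis V_ge2 : (2 <= #|V|)%N.

Let ZE : R -> R := powsum (mem (edges adj)) (fun f => (edge_deg adj f)%:R).
Let ZV : R -> R := powsum predT (fun v => (deg adj v)%:R ^+ 2).

Let edge_weight_gt0 (f : {set V}) : 0 < (edge_deg adj f)%:R :> R.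
Proof. by rewrite ltr0n edge_deg_gt0. Qed.

Let vertex_weight_gt0 (v : V) : 0 < (deg adj v)%:R ^+ 2 :> R.
Proof. by rewrite exprn_gt0// ltr0n deg_gt0. Qed.

Let ZE_gt0 (b : R) : 0 < ZE b.
Proof.
have [f fE] := exists_edge adj_connected V_ge2.
exact: (powsum_gt0 _ _ _ _ _ f).
Qed.

Let ZV_gt0 (b : R) : 0 < ZV b.
Proof.
have [v _] := exists_vertex V_ge2.
exact: (powsum_gt0 _ _ _ _ _ v).
Qed.

Lemma normalized_randic_powsum (b : R) : normalized_randic adj b = ZE b / ZV b.
Proof.
congr (_ / _); apply: eq_bigr => v _.
by rewrite powRrM (powR_mulrn 2) ?ler0n.
Qed.

Lemma normalized_randic_gt0 (b : R) : 0 < normalized_randic adj b.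
Proof. by rewrite normalized_randic_powsum divr_gt0. Qed.

Definition dlog2_randic (b : R) : R :=
  dpowsum (mem (edges adj)) (fun f => (edge_deg adj f)%:R) b / ZE b / ln 2
  - dpowsum predT (fun v => (deg adj v)%:R ^+ 2) b / ZV b / ln 2.

Lemma is_derive_log2_randic (b : R) :
  is_derive b 1 (fun c => log2 (normalized_randic adj c)) (dlog2_randic b).
Proof.
have -> : (fun c => log2 (normalized_randic adj c))
          = (fun c => log2 (ZE c)) - (fun c => log2 (ZV c)).
  by apply/funext => c; rewrite normalized_randic_powsum log2_div.
by apply: is_deriveB; apply: is_derive_log2_powsum.
Qed.

(** Unlike the derivative formula divided by [b], this identity also covers
    [b = 0], where [R] may reach its maximum. *)
Lemma randic_entropy_balance (b : R) :
  b * dlog2_randic b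
  = log2 (normalized_randic adj b) + vertex_entropy adj b - edge_entropy adj b.
Proof.
have HE : edge_entropy adj b = _ := gibbs_entropy _ _ _ _ b
  (fun f _ => edge_weight_gt0 f) (ZE_gt0 b).
have HV : vertex_entropy adj b = _ := gibbs_entropy _ _ _ _ b
  (fun v _ => vertex_weight_gt0 v) (ZV_gt0 b).
rewrite HE HV normalized_randic_powsum log2_div// /dlog2_randic /ZE /ZV.
by ring.
Qed.

(** Fermat's rule on an interval around [a]: [log2] is increasing, so a maximum
    of [R] is one of [log2 \o R]. *)
Lemma dlog2_randic_at_max (a : R) :
  (forall b, normalized_randic adj b <= normalized_randic adj a) ->
  dlog2_randic a = 0.
Proof.
move=> amax; have dera := is_derive_log2_randic a.
suff : is_derive a 1 (fun b : R => log2 (normalized_randic adj b)) 0.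
  by move=> [_ <-]; rewrite derive_val.
apply: (@derive1_at_max _ _ (a - 1) (a + 1)).
- by rewrite lerD2l (le_trans (lerN10 R)).
- by move=> t _; have [] := is_derive_log2_randic t.
- by rewrite in_itv /= ltrBlDr !ltrDl ltr01.
- move=> t _; rewrite /log2 ler_pM2r ?invr_gt0 ?ln2_gt0//.
  by rewrite ler_ln ?posrE ?normalized_randic_gt0.
Qed.

End Randic.

Theorem theorem6 (R : realType) (V : finType) (adj : rel V)
    (adj_simple : simple_graph adj)
    (adj_connected : connected_graph adj)
    (V_ge2 : (2 <= #|V|)%N) :
  (forall a : R, a != 0 ->
    is_derive a 1 (fun b : R => log2 (normalized_randic adj b))
      (a^-1 * (log2 (normalized_randic adj a)
               + vertex_entropy adj a - edge_entropy adj a))) /\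
  (forall astar : R,
    (forall b : R, normalized_randic adj b <= normalized_randic adj astar) ->
    log2 (normalized_randic adj astar)
      = edge_entropy adj astar - vertex_entropy adj astar).
Proof.
split=> [a a0|a amax].
  rewrite -(randic_entropy_balance adj_connected V_ge2) mulKf//.
  exact: is_derive_log2_randic.
have := randic_entropy_balance adj_connected V_ge2 a.
rewrite (dlog2_randic_at_max adj_connected V_ge2 _ amax) mulr0.
by move/esym/eqP; rewrite subr_eq0 => /eqP <-; rewrite addrK.
Qed.
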